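(* Let $M\in\mathbb N$, $q_{\min}>0$, $\kappa\in(0,1]$, $\beta>0$, $K_0>0$, and $a:=\min\{(\beta+1)/(2\beta+d_U),\,1/2\}$. Let $\mathcal C_M(q_{\min},\kappa;\beta,K_0)$ be the class of finite-state causal models $(P_{\mathrm{obs}},P^\ast)$ and $\hat g_n^{\mathrm{disc}}$ the stratified finite-state WGAN estimator, both defined in the context. Then there exist constants $C,c>0$, depending only on $(M,q_{\min},\kappa,\beta,d_U,K_0)$, such that for all $n\ge 2$ $$\sup_{(P_{\mathrm{obs}},P^\ast)\in\mathcal C_M(q_{\min},\kappa;\beta,K_0)}\mathbb E\big[\mathrm{eW}_1(P^\ast,P_{\hat g_n^{\mathrm{disc}}})\big]\le C(\log n)^c\,n^{-a}.$$
   Context: **Setting.** $\mathcal Y\subset\mathbb R^p$ is compact and contained in $B^p(0,K_0)=\{y\in\mathbb R^p:\|y\|\le K_0\}$; $W_1$ is the Wasserstein-1 distance on $\mathcal Y$ for the Euclidean norm. $U\sim\mathrm{Unif}([0,1]^{d_U})$, and $g_\#U$ denotes the law of $g(U)$; $[0,1]^{d_U}$ is identified with the torus $\mathbb T^{d_U}$. For $s>0$, $\mathcal H^{s}_{K_0}(\mathbb T^{d_U},\mathbb R^p)$ is the periodic Hölder ball of maps $g:\mathbb T^{d_U}\to\mathbb R^p$ with image in $B^p(0,K_0)$, derivatives up to order $\lfloor s\rfloor$ bounded by $K_0$, and top-order derivatives $(s-\lfloor s\rfloor)$-Hölder continuous (with constant $K_0$) when $s$ is not an integer. **Causal model.** $X$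 are covariates, $T$ a treatment, $Y(t)\in\mathcal Y$ potential outcomes, $W=(X,T)$ is the state, taking values in a finite set identified with $\{1,\dots,M\}$, and $Y^{\mathrm{obs}}$ is the observed outcome. Consistency: $Y^{\mathrm{obs}}=Y(T)$ a.s. Ignorability: $Y(t)\perp T\mid X$ for every $t$. For $w=(x,t)$, $\mu_w^\ast$ is the law of $Y(t)$ given $X=x$; for state $j$ write $\mu_j^\ast$. $\pi_j=Q_{\mathrm{obs}}(\{j\})$ is the observational probability of state $j$, and $q_j=Q_\rho(\{j\})$ is its probability under a known target design $Q_\rho$. Overlap: $q_j\le\kappa^{-1}\pi_j$ for all $j$. Under these assumptions the law of $(W,Y^{\mathrm{obs}})$ is $P_{\mathrm{obs}}=\sum_j\pi_j\,\delta_j\otimes\mu_j^\ast$, and the target is $P^\ast=\sum_j q_j\,\delta_j\otimes\mu_j^\ast$. The class $\mathcal C_M(q_{\min},\kappa;\beta,K_0)$ consists of all such models satisfying consistency, ignorability, overlap, $q_j\ge q_{\min}$, and $\mu_j^\ast=(g_j^\ast)_\#U$ with $g_j^\ast\in\mathcal H^{\beta+1}_{K_0}(\mathbb T^{d_U},\mathbb R^p)$ for all $j$. The data are i.i.d. $(W_i,Y_i^{\mathrm{obs}})\sim P_{\mathrm{obs}}$, $i=1,\dots,n$. **Extended Wasserstein distance.** For laws $P=Q(dw)\mu_w(dy)$ and $R=Q(dw)\nu_w(dy)$ with the same state marginal $Q$, $\mathrm{eW}_1(P,R)=\inf_\alpha\int\|y-y'\|\,d\alpha$, the infimum being over couplings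 $\alpha$ of $P$ and $R$ on $(\mathcal W\times\mathcal Y)^2$ under which the two state coordinates are equal; equivalently $\mathrm{eW}_1(P,R)=\int W_1(\mu_w,\nu_w)\,Q(dw)$. **One-state WGAN sieves.** For every integer $N\ge2$, $\mathcal G_N^\circ$ is a class of measurable maps $[0,1]^{d_U}\to\mathcal Y$ and $\mathcal D_N^\circ$ is a finite class of Lipschitz functions on $\mathcal Y$. These are the generator and critic classes of the known unconditional WGAN theory (Stéphanovitch et al.), which have the following oracle property. For all $m\ge1$ and $N\asymp m\vee 2$ (ratios bounded above and below by fixed constants), if $\eta^\ast=(g^\ast)_\#U$ with $g^\ast\in\mathcal H^{\beta+1}_{K_0}(\mathbb T^{d_U},\mathbb R^p)$, $Z_1,\dots,Z_m\sim\eta^\ast$ are i.i.d., $U_1,\dots,U_{m'}$ is an independent i.i.d. sample of copies of $U$ with $m'\ge m\wedge N$, and $\hat g\in\mathcal G_N^\circ$ minimizes up to $1/m$ the map $g\mapsto\sup_{D\in\mathcal D_N^\circ}\{\frac1m\sum_iD(Z_i)-\frac1{m'}\sum_\ell D(g(U_\ell))\}$ over $\mathcal G_N^\circ$, then $\mathbb E[W_1(\eta^\ast,\hat g_\#U)]\le C_1(\log(m\vee2))^{c_1}(m\vee1)^{-a}$, with $C_1,c_1$ depending only on $(\beta,d_U,K_0)$ (and the ratio constants). **Estimator.** Fix an anchor $y_0\in\mathcal Y$. For $f:\mathcal Y\to\mathbb R$ let $\hat E^{\mathrm{obs}}_{j,n}f$ be the average of $f(Y_i^{\mathrm{obs}})$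 over $\{i:W_i=j\}$ if this set is non-empty, and $f(y_0)$ otherwise. Let $U_{\ell j}$ ($1\le\ell\le n$, $1\le j\le M$) be i.i.d. copies of $U$, independent of the data. For $g=(g_1,\dots,g_M)\in(\mathcal G_n^\circ)^M$ and $D=(D_1,\dots,D_M)\in(\mathcal D_n^\circ)^M$ put $$\hat L_n^{\mathrm{disc}}(g,D)=\sum_{j=1}^M q_j\Big[\hat E^{\mathrm{obs}}_{j,n}D_j-\frac1n\sum_{\ell=1}^nD_j(g_j(U_{\ell j}))\Big],$$ and let $\hat g_n^{\mathrm{disc}}\in\arg\min_{g\in(\mathcal G_n^\circ)^M}\sup_{D\in(\mathcal D_n^\circ)^M}\hat L_n^{\mathrm{disc}}(g,D)$. For $g=(g_1,\dots,g_M)$, $P_g=\sum_jq_j\,\delta_j\otimes(g_j)_\#U$. *)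

(* Defs.v *)
From HB Require Import structures.
From mathcomp Require Import all_boot all_order all_algebra.
From mathcomp Require Import all_classical all_reals all_analysis.
From mathcomp Require Import measurable_realfun.

Set Implicit Arguments.
Unset Strict Implicit.
Unset Printing Implicit Defensive.

Import Order.TTheory GRing.Theory Num.Theory.
Import numFieldNormedType.Exports.

Local Open Scope classical_set_scope.
Local Open Scope ring_scope.

(* A finite state space needs a point for the library's measurable types, hence
   the successor: 'I_M.+1 stands for M.+1 states. *)
HB.instance Definition _ (M : nat) := isPointed.Build 'I_M.+1 ord0.

HB.instance Definition _ (M : nat) :=
  @isMeasurable.Build default_measure_display 'I_M.+1
    (@discrete_measurable 'I_M.+1) (@discrete_measurable0 _)
    (@discrete_measurableC _) (@discrete_measurableU _).

(* Row vectors carry the sigma-algebra generated by the coordinates, as the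
   library does for tuples; over the reals this is the Borel sigma-algebra. *)
Definition measure_rV_display : measure_display -> measure_display.
Proof. exact. Qed.

Section measurable_rV.
Context {d} {T : measurableType d}.
Variable n : nat.

Let coord : 'I_n -> 'rV[T]_n -> T := fun i v => v ord0 i.

Let rV_set0 : g_sigma_preimage coord set0.
Proof. exact: sigma_algebra0. Qed.

Let rV_setC A : g_sigma_preimage coord A -> g_sigma_preimage coord (~` A).
Proof. exact: sigma_algebraC. Qed.

Let rV_bigcup (F : _^nat) : (forall i, g_sigma_preimage coord (F i)) ->
  g_sigma_preimage coord (\bigcup_i (F i)).
Proof. exact: sigma_algebra_bigcup. Qed.

HB.instance Definition _ := @isMeasurable.Build (measure_rV_display d)
  'rV[T]_n (g_sigma_preimage coord) rV_set0 rV_setC rV_bigcup.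

Lemma measurable_coord (i : 'I_n) :
  measurable_fun [set: 'rV[T]_n] (fun v => v ord0 i).
Proof.
move=> _ Y mY; rewrite setTI; apply: sub_sigma_algebra => /=.
rewrite -bigcup_seq/=; exists i => /=; first by rewrite mem_index_enum.
by exists Y => //; rewrite setTI.
Qed.

End measurable_rV.

Lemma measurable_fun_rV d1 d2 (T1 : measurableType d1) (T2 : measurableType d2)
    (n : nat) (f : T1 -> 'rV[T2]_n) :
  (forall i, measurable_fun [set: T1] (fun x => f x ord0 i)) ->
  measurable_fun [set: T1] f.
Proof.
move=> mf _ A mA; rewrite setTI; move: A mA.
pose coord (i : 'I_n) (v : 'rV[T2]_n) := v ord0 i.
have H : g_sigma_preimage (fun i => coord i \o f) `<=` measurable.
  apply: smallest_sub; first exact: sigma_algebra_measurable.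
  rewrite -bigcup_seq; apply: bigcup_sub => i _.
  by move=> A [B mB <-]; exact: mf.
rewrite g_sigma_preimage_comp in H.
by move=> A mA; apply: H; exists A => //; rewrite setTI.
Qed.

Section uniform_cube.
Variable R : realType.

Definition row_cons n (xv : measurableTypeR R * 'rV[R]_n) : 'rV[R]_n.+1 :=
  \row_i (if unlift ord0 i is Some j then xv.2 ord0 j else xv.1).

Lemma measurable_row_cons n : measurable_fun setT (@row_cons n).
Proof.
apply: measurable_fun_rV => i.
rewrite (_ : (fun _ => _) = fun xv : measurableTypeR R * 'rV[R]_n =>
    if unlift ord0 i is Some j then xv.2 ord0 j else xv.1 : R); last first.
  by apply/funext => xv; rewrite mxE.
case: (unlift ord0 i) => [j|]; last exact: measurable_fst.
exact: measurableT_comp (measurable_coord j) measurable_snd.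
Qed.

HB.instance Definition _ n :=
  @isMeasurableFun.Build _ _ _ _ (@row_cons n) (@measurable_row_cons n).

Fixpoint unif_cube (n : nat) : probability 'rV[R]_n R :=
  match n with
  | 0 => dirac (0 : 'rV[R]_0)
  | n'.+1 =>
    distribution (uniform_prob (@ltr01 R) \x unif_cube n')%E
      (@row_cons n' : {mfun _ >-> 'rV[R]_n'.+1})
  end.

End uniform_cube.


Section euclidean.
Variable R : realType.

(* The library's norm on row vectors is the sup norm. *)
Definition enorm n (v : 'rV[R]_n) : R := Num.sqrt (\sum_(i < n) v ord0 i ^+ 2).

Definition cube n : set 'rV[R]_n := [set u | forall i, 0 <= u ord0 i <= 1].

(* The law g_#U for U ~ Unif([0,1]^n); only the values of g on the cube enter. *)
Definition gen_law n p (g : 'rV[R]_n -> 'rV[R]_p) (A : set 'rV[R]_p) : \bar R :=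
  unif_cube R n (@cube n `&` g @^-1` A).

End euclidean.

Arguments cube R n : clear implicits.

Section hoelder_ball.
Variables (R : realType) (n p : nat).
Implicit Types g : 'rV[R]_n -> 'rV[R]_p.

Definition unit_vec (i : 'I_n) : 'rV[R]_n := delta_mx ord0 i.

(* Iterated partial derivative; a multi-index is given as a list of directions. *)
Definition partial (l : seq 'I_n) g : 'rV[R]_n -> 'rV[R]_p :=
  foldr (fun i f => 'D_(unit_vec i) f) g l.

Definition periodic g := forall u i, g (u + unit_vec i) = g u.

(* Functions on the torus are Z^n-periodic functions on R^n; for these a Hoelder
   bound in the torus distance is the same as one in the Euclidean distance. *)
Definition hoelder_ball (s K : R) g : Prop :=
  let k := Num.truncn s in
  [/\ periodic g,
      forall l, (size l < k)%N ->
        forall i u, derivable (partial l g) u (unit_vec i),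
      forall l, (size l <= k)%N -> continuous (partial l g),
      forall l, (size l <= k)%N -> forall u, enorm (partial l g u) <= K &
      s != k%:R -> forall l, size l = k -> forall u v,
        enorm (partial l g u - partial l g v) <= K * enorm (u - v) `^ (s - k%:R)].

End hoelder_ball.

Section wasserstein.
Variables (R : realType) (p : nat).
Local Notation rV := 'rV[R]_p.

Definition couplings d (T : measurableType d) (mu nu : set T -> \bar R) :
    set (probability (T * T)%type R) :=
  [set alpha | forall A, measurable A ->
     alpha (A `*` setT) = mu A /\ alpha (setT `*` A) = nu A].

Definition W1 (mu nu : set rV -> \bar R) : \bar R :=
  ereal_inf [set (\int[alpha]_z (enorm (z.1 - z.2))%:E)%E
            | alpha in couplings mu nu].

Definition eW1 M (P Q : set ('I_M.+1 * rV) -> \bar R) : \bar R :=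
  ereal_inf [set (\int[alpha]_z (enorm (z.1.2 - z.2.2))%:E)%E
            | alpha in [set alpha | couplings P Q alpha /\
                          {ae alpha, forall z, z.1.1 = z.2.1}]].

(* \sum_j q_j \delta_j \otimes mu_j *)
Definition state_mix M (q : 'I_M.+1 -> R) (mu : 'I_M.+1 -> set rV -> \bar R)
    (A : set ('I_M.+1 * rV)) : \bar R :=
  (\sum_j (q j)%:E * mu j (xsection A j))%E.

End wasserstein.

Section probability_notions.
Variables (R : realType) (d : measure_display) (Omega : measurableType d).
Variable P : probability Omega R.

(* Equal to 0 when P B = 0. *)
Definition cprob (A B : set Omega) : R := fine (P (A `&` B)) / fine (P B).

Definition sigma_of d' (T : measurableType d') (X : Omega -> T) :
    set (set Omega) :=
  preimage_set_system setT X measurable.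

(* For families of sigma-algebras the product rule over the whole index set
   contains the one over every subset of indices. *)
Definition mutually_independent (I : finType) (F : I -> set (set Omega)) :=
  forall E : I -> set Omega, (forall i, F i (E i)) ->
    P (\bigcap_i E i) = (\prod_i P (E i))%E.

Definition has_law d' (T : measurableType d') (X : Omega -> T)
    (mu : set T -> \bar R) :=
  measurable_fun setT X /\ forall A, measurable A -> P (X @^-1` A) = mu A.

End probability_notions.

Section causal.
Variables (R : realType) (M p : nat) (Y : set 'rV[R]_p).

(* The covariate and the treatment are the two components of the state, so the
   state space is a set of M.+1 pairs (x, t). *)
Record causal_model := CausalModel {
  covariates : Type;
  treatments : Type;
  state : 'I_M.+1 -> covariates * treatments;
  cm_disp : measure_display;
  cm_space : measurableType cm_disp;
  cm_prob : probability cm_space R;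
  cm_W : cm_space -> 'I_M.+1;
  cm_Y : treatments -> cm_space -> 'rV[R]_p;
  cm_Yobs : cm_space -> 'rV[R]_p;
  state_inj : injective state;
  cm_W_meas : measurable_fun setT cm_W;
  cm_Y_meas : forall t, measurable_fun setT (cm_Y t);
  cm_Yobs_meas : measurable_fun setT cm_Yobs;
  cm_Y_in : forall t w, Y (cm_Y t w);
  cm_Yobs_in : forall w, Y (cm_Yobs w) }.

Variable m : causal_model.

Definition cm_X (w : cm_space m) : covariates m := (state m (cm_W w)).1.
Definition cm_T (w : cm_space m) : treatments m := (state m (cm_W w)).2.

Definition consistency : Prop :=
  {ae cm_prob m, forall w, cm_Yobs w = cm_Y (cm_T w) w}.

(* Conditional independence given a covariate with finitely many values. *)
Definition ignorability : Prop :=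
  forall t x (A : set 'rV[R]_p) (B : set (treatments m)), measurable A ->
    let X_x := cm_X @^-1` [set x] in
    cprob (cm_prob m) (cm_Y t @^-1` A `&` cm_T @^-1` B) X_x =
    cprob (cm_prob m) (cm_Y t @^-1` A) X_x * cprob (cm_prob m) (cm_T @^-1` B) X_x.

(* The law of Y(t) given X = x, for the state j = (x, t). *)
Definition mu_star (j : 'I_M.+1) (A : set 'rV[R]_p) : \bar R :=
  (cprob (cm_prob m) (cm_Y (state m j).2 @^-1` A)
     (cm_X @^-1` [set (state m j).1]))%:E.

Definition pi_obs (j : 'I_M.+1) : R := fine (cm_prob m (@cm_W m @^-1` [set j])).

Definition P_obs : set ('I_M.+1 * 'rV[R]_p) -> \bar R :=
  pushforward (cm_prob m) (fun w => (cm_W w, cm_Yobs w)).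

(* q is the target design, which varies with the model. *)
Definition model_class dU (qmin kappa beta K0 : R) (q : 'I_M.+1 -> R) : Prop :=
  [/\ consistency /\ ignorability,
      \sum_j q j = 1,
      forall j, qmin <= q j,
      forall j, q j <= kappa^-1 * pi_obs j &
      forall j, exists2 g : 'rV[R]_dU -> 'rV[R]_p,
        hoelder_ball (beta + 1) K0 g &
        forall A, measurable A -> mu_star j A = gen_law g A].

End causal.

Definition rate (R : realType) (beta : R) (dU : nat) : R :=
  Num.min ((beta + 1) / (2 * beta + dU%:R)) (2^-1).

Section wgan.
Variables (R : realType) (dU p : nat) (Y : set 'rV[R]_p).
Local Notation gen := ('rV[R]_dU -> 'rV[R]_p).
Local Notation critic := ('rV[R]_p -> R).

(* Generators are maps on the cube and critics maps on Y, both represented by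
   functions on the ambient space whose other values are never used. *)
Definition sieve_classes (G : nat -> set gen) (D : nat -> set critic) : Prop :=
  forall N, (2 <= N)%N ->
    [/\ forall g, G N g ->
          measurable_fun (cube R dU) g /\ forall u, cube R dU u -> Y (g u),
        finite_set (D N) &
        forall D0, D N D0 -> exists L : R, forall y y', Y y -> Y y' ->
          `|D0 y - D0 y'| <= L * enorm (y - y')].

(* ghat is an eps-minimizer over Gs of the worst-case loss over Ds. *)
Definition minmax T S (Gs : set T) (Ds : set S) (L : T -> S -> R) (eps : R)
    (ghat : T) : Prop :=
  Gs ghat /\ forall g, Gs g ->
    sup [set L ghat D | D in Ds] <= sup [set L g D | D in Ds] + eps.

Definition loss1 m m' (z : 'I_m -> 'rV[R]_p) (u : 'I_m' -> 'rV[R]_dU)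
    (g : gen) (D : critic) : R :=
  m%:R^-1 * (\sum_i D (z i)) - m'%:R^-1 * (\sum_l D (g (u l))).

Definition oracle (beta K0 : R) (C1 c1 : R -> R -> R)
    (G : nat -> set gen) (D : nat -> set critic) : Prop :=
  forall (r1 r2 : R) (m N m' : nat), 0 < r1 -> 0 < r2 ->
  (1 <= m)%N -> (2 <= N)%N ->
  r1 * (maxn m 2)%:R <= N%:R <= r2 * (maxn m 2)%:R ->
  (minn m N <= m')%N ->
  forall gstar : gen, hoelder_ball (beta + 1) K0 gstar ->
  forall (d : measure_display) (Omega : measurableType d)
    (P : probability Omega R)
    (Z : 'I_m -> Omega -> 'rV[R]_p) (U : 'I_m' -> Omega -> 'rV[R]_dU)
    (ghat : Omega -> gen),
  (forall i, has_law P (Z i) (gen_law gstar)) ->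
  (forall i w, Y (Z i w)) ->
  (forall l, has_law P (U l) (unif_cube R dU)) ->
  (forall l w, cube R dU (U l w)) ->
  mutually_independent P (fun s : 'I_m + 'I_m' =>
    match s with inl i => sigma_of (Z i) | inr l => sigma_of (U l) end) ->
  {ae P, forall w, minmax (G N) (D N)
    (loss1 (fun i => Z i w) (fun l => U l w)) m%:R^-1 (ghat w)} ->
  measurable_fun setT
    (fun w => W1 (gen_law gstar) (gen_law (ghat w))) ->
  (\int[P]_w W1 (gen_law gstar) (gen_law (ghat w)) <=
    (C1 r1 r2 * ln (maxn m 2)%:R `^ c1 r1 r2 * (maxn m 1)%:R `^ (- rate beta dU))%:E)%E.

Section estimator.
Variables (M n : nat) (q : 'I_M.+1 -> R) (y0 : 'rV[R]_p).

Definition E_obs (W : 'I_n -> 'I_M.+1) (Yo : 'I_n -> 'rV[R]_p) (j : 'I_M.+1)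
    (f : critic) : R :=
  let k := #|[set i | W i == j]%SET| in
  if (k == 0)%N then f y0 else k%:R^-1 * \sum_(i | W i == j) f (Yo i).

Definition L_disc (W : 'I_n -> 'I_M.+1) (Yo : 'I_n -> 'rV[R]_p)
    (U : 'I_n * 'I_M.+1 -> 'rV[R]_dU)
    (g : 'I_M.+1 -> gen) (D : 'I_M.+1 -> critic) : R :=
  \sum_j q j * (E_obs W Yo j (D j) - n%:R^-1 * \sum_l D j (g j (U (l, j)))).

Definition prod_class T (A : set T) : set ('I_M.+1 -> T) :=
  [set f | forall j, A (f j)].

(* The data are i.i.d. with law Pobs, the latent draws i.i.d. uniform, and all
   of them are independent. *)
Definition iid_sample d (Omega : measurableType d) (P : probability Omega R)
    (Pobs : set ('I_M.+1 * 'rV[R]_p) -> \bar R)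
    (W : 'I_n -> Omega -> 'I_M.+1) (Yo : 'I_n -> Omega -> 'rV[R]_p)
    (U : 'I_n * 'I_M.+1 -> Omega -> 'rV[R]_dU) : Prop :=
  [/\ forall i, has_law P (fun w => (W i w, Yo i w)) Pobs,
      forall i w, Y (Yo i w),
      forall lj, has_law P (U lj) (unif_cube R dU),
      forall lj w, cube R dU (U lj w) &
      mutually_independent P (fun s : 'I_n + 'I_n * 'I_M.+1 =>
        match s with
        | inl i => sigma_of (fun w => (W i w, Yo i w))
        | inr lj => sigma_of (U lj)
        end)].

Definition wgan_estimator d (Omega : measurableType d) (P : probability Omega R)
    (W : 'I_n -> Omega -> 'I_M.+1) (Yo : 'I_n -> Omega -> 'rV[R]_p)
    (U : 'I_n * 'I_M.+1 -> Omega -> 'rV[R]_dU)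
    (G : set gen) (D : set critic) (ghat : Omega -> 'I_M.+1 -> gen) : Prop :=
  {ae P, forall w, minmax (prod_class G) (prod_class D)
    (L_disc (W^~ w) (Yo^~ w) (U^~ w)) 0 (ghat w)}.

End estimator.

End wgan.

(* Main.v *)
Require Import Defs.
From HB Require Import structures.
From mathcomp Require Import all_boot all_order all_algebra.
From mathcomp Require Import all_classical all_reals all_analysis.
From mathcomp Require Import measurable_realfun.
From mathcomp Require Import ring lra.

(* A diagonal mixture of near-optimal couplings of the state laws gives
   [eW1 <= \sum_j q_j W1 (mu_j) (ghat_j # U)], so the problem splits into one
   problem per state j.  The worst-case loss is a sum of terms each involving one
   generator and one critic, and q_j > 0, hence the component [ghat_j] minimizes
   its own one-state loss.  Now split the sample space according to the set
   S = {i | W_i = j}.  Given S, the outcomes (Y_i)_(i in S) are i.i.d. of law mu_j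
   (consistency, ignorability) and independent of the latent draws, so the oracle
   property with m = |S| and N = m' = n applies, under the conditional probability,
   as long as |S| >= n pi_j / 4, because pi_j >= kappa qmin keeps the ratio n / |S|
   bounded.  The remaining event has probability at most exp (- n pi_j / 4) by a
   Chernoff bound, and there W1 <= 2 K0. *)

Set Implicit Arguments.
Unset Strict Implicit.
Unset Printing Implicit Defensive.

Import Order.TTheory GRing.Theory Num.Theory.
Import numFieldNormedType.Exports.

Local Open Scope classical_set_scope.
Local Open Scope ring_scope.

(** * Monotonicity and finite decomposition of nonnegative integrals *)

Section integral_lemmas.
Context d (T : measurableType d) (R : realType).
Implicit Types f g : T -> \bar R.

(* Unlike [ge0_le_integral], this needs no measurability, which is not available
   for the extended distance as a function of the sample. *)
Lemma ge0_le_integral_nomeas (mu : measure T R) f g :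
  (forall x, (0 <= f x)%E) -> (forall x, (f x <= g x)%E) ->
  (\int[mu]_x f x <= \int[mu]_x g x)%E.
Proof.
move=> f0 fg; have g0 x : (0 <= g x)%E by exact: le_trans (fg x).
rewrite !ge0_integralE//; apply: le_ereal_sup => _ [h /= hf <-].
exists h => //= x; apply: le_trans (hf x) _.
by rewrite !patch_setT.
Qed.

Lemma ge0_integral_finpartition (I : finType) (mu : measure T R)
    (E : I -> set T) f :
  (forall i, measurable (E i)) -> trivIset setT E -> \bigcup_i E i = setT ->
  (forall x, (0 <= f x)%E) -> measurable_fun setT f ->
  (\int[mu]_x f x = \sum_i \int[mu]_(x in E i) f x)%E.
Proof.
move=> mE tE UE f0 mf.
have {}UE : setT = \big[setU/set0]_(i <- index_enum I) E i.
  rewrite -UE -bigcup_seq; apply/seteqP; split=> x [i _ Eix]; exists i => //.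
  by rewrite /= mem_index_enum.
rewrite [in LHS]UE ge0_integral_bigsetU//.
- exact: index_enum_uniq.
- exact: sub_trivIset tE.
- by apply: measurable_funS mf.
Qed.

End integral_lemmas.

(** * Conditioning on an event *)

Section conditioning.
Context d (T : measurableType d) (R : realType) (P : probability T R).
Variables (E : set T) (mE : measurable E).

(** [mnormalize] falls back on its last argument, here [P], when [P E] is 0, so this is a
    probability for every measurable [E]. *)
Definition conditional : probability T R := mnormalize (mrestr P mE) P.

Hypothesis PE0 : P E != 0%E.

Lemma conditionalE A : conditional A = (P (A `&` E) * ((fine (P E))^-1)%:E)%E.
Proof.
rewrite /conditional /= /mnormalize /=.
have -> : mrestr P mE setT = P E by rewrite /mrestr setTI.
by rewrite (negPf PE0) /= ifF//; apply/negbTE; rewrite -ltey ltey_eq fin_num_measure.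
Qed.

(** On [E] the conditional measure is [P] scaled by the inverse of [P E], and the complement of [E]
    is null for it. *)
Lemma ge0_integral_conditional f :
  (forall x, (0 <= f x)%E) -> measurable_fun setT f ->
  (\int[P]_(x in E) f x = P E * \int[conditional]_x f x)%E.
Proof.
move=> f0 mf.
have PEf : P E \is a fin_num by exact: fin_num_measure.
have cge0 : 0 <= (fine (P E))^-1 by rewrite invr_ge0 fine_ge0.
pose c : {nonneg R} := NngNum cge0.
have -> : (\int[conditional]_x f x = \int[conditional]_(x in E) f x)%E.
  rewrite -(setUv E) ge0_integral_setU//; last 3 first.
  - exact: measurableC.
  - by rewrite setUv.
  - exact/disj_set2P/setICr.
  rewrite [X in (_ + X)%E]null_set_integral ?adde0//.
  - exact: measurableC.
  - exact: measurable_funS mf.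
  - by apply: etrans (conditionalE _) _; rewrite setICl measure0 mul0e.
rewrite [in RHS](@eq_measure_integral _ _ _ _ (mscale c P)); last first.
  move=> A mA AE; apply: etrans (conditionalE _) _.
  by rewrite (setIidl AE) /mscale /= muleC.
rewrite ge0_integral_mscale//; last exact: measurable_funS mf.
rewrite muleA -{1}(fineK PEf) /= -EFinM mulfV ?mul1e//.
by rewrite fine_eq0.
Qed.

End conditioning.

(** * The Euclidean norm: measurability and the diameter of a ball *)

Section enorm_lemmas.
Context (R : realType).

Lemma enorm_ge0 n (v : 'rV[R]_n) : 0 <= enorm v.
Proof. exact: sqrtr_ge0. Qed.

Lemma measurable_enorm_dist n :
  measurable_fun [set: 'rV[R]_n * 'rV[R]_n] (fun z => (enorm (z.1 - z.2))%:E).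
Proof.
apply/measurable_EFinP; apply: (@measurableT_comp _ _ _ _ _ _ (@Num.sqrt R)).
  exact: continuous_measurable_fun (@sqrt_continuous R).
apply: measurable_sum => i; apply: measurable_funX.
rewrite (_ : (fun _ => _) =
    (fun z : 'rV[R]_n * 'rV[R]_n => z.1 ord0 i) \- (fun z => z.2 ord0 i)); last first.
  by apply/funext => z; rewrite !mxE.
apply: measurable_funB.
- exact: measurableT_comp (measurable_coord i) measurable_fst.
- exact: measurableT_comp (measurable_coord i) measurable_snd.
Qed.

Lemma measurable_enorm_le n (K : R) :
  measurable [set y : 'rV[R]_n | enorm y <= K].
Proof.
pose f (y : 'rV[R]_n) : \bar R := (enorm y)%:E.
have mf : measurable_fun setT f.
  rewrite (_ : f = (fun z => (enorm (z.1 - z.2))%:E) \o (fun y => (y, 0))).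
    apply: (measurableT_comp (@measurable_enorm_dist n)).
    exact: measurable_fun_pair.
  by apply/funext => y /=; rewrite subr0.
have := mf measurableT [set` `]-oo, K%:E]%R] (emeasurable_itv _).
by rewrite setTI; congr measurable; apply/seteqP; split => y /=;
  rewrite in_itv /= lee_fin.
Qed.

Lemma enorm_sub_le n (u v : 'rV[R]_n) (K : R) :
  enorm u <= K -> enorm v <= K -> enorm (u - v) <= 2 * K.
Proof.
move=> uK vK; have K0 : 0 <= K by exact: le_trans (enorm_ge0 u) uK.
have sq (w : 'rV[R]_n) : enorm w <= K -> \sum_i w ord0 i ^+ 2 <= K ^+ 2.
  move=> wK; rewrite -[leLHS]sqr_sqrtr ?ler_pXn2r ?nnegrE ?enorm_ge0//.
  by apply: sumr_ge0 => i _; rewrite sqr_ge0.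
rewrite -[leRHS]ger0_norm ?mulr_ge0// -sqrtr_sqr ler_sqrt ?sqr_ge0//.
apply: (@le_trans _ _
    (2 * \sum_i u ord0 i ^+ 2 + 2 * \sum_i v ord0 i ^+ 2)); last first.
  have := sq u uK; have := sq v vK; rewrite exprMn; lra.
(* Coordinatewise, [(a - b)^2 <= 2 a^2 + 2 b^2] follows from [0 <= (a + b)^2]; summed up, it yields
   the bound [4 K^2] on the squared norm. *)
rewrite !mulr_sumr -big_split; apply: ler_sum => i _; rewrite !mxE /=.
have := sqr_ge0 (u ord0 i + v ord0 i); nra.
Qed.

End enorm_lemmas.

(** * Elementary properties of the Wasserstein distances *)

Section wasserstein_lemmas.
Context (R : realType) (p : nat).
Local Notation rV := 'rV[R]_p.

Lemma W1_ge0 (mu nu : set rV -> \bar R) : (0 <= W1 mu nu)%E.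
Proof.
apply: le_ereal_inf_tmp => _ [alpha _ <-].
by apply: integral_ge0 => z _; rewrite lee_fin enorm_ge0.
Qed.

Lemma eW1_ge0 M (mu nu : set ('I_M.+1 * rV) -> \bar R) : (0 <= eW1 mu nu)%E.
Proof.
apply: le_ereal_inf_tmp => _ [alpha _ <-].
by apply: integral_ge0 => z _; rewrite lee_fin enorm_ge0.
Qed.

(** Couplings test their marginals on measurable sets only. This allows [mu_star] and [gen_law],
    which are plain set functions, to be exchanged for genuine measures. *)
Lemma eq_W1 (mu mu' nu : set rV -> \bar R) :
  (forall A, measurable A -> mu A = mu' A) -> W1 mu nu = W1 mu' nu.
Proof.
move=> mumu'; rewrite /W1; congr (ereal_inf (image _ _)).
apply/seteqP; split => alpha alphaP A mA.
- by rewrite -mumu'//; exact: alphaP.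
- by rewrite mumu'//; exact: alphaP.
Qed.

(** The product coupling is concentrated on pairs of points of the ball, and these are at distance
    at most [2 * K]. *)
Lemma W1_le_bound (mu nu : probability rV R) (K : R) :
  mu [set y | enorm y <= K] = 1%E -> nu [set y | enorm y <= K] = 1%E ->
  (W1 mu nu <= (2 * K)%:E)%E.
Proof.
set B := [set y : rV | _] => muB nuB.
have mB : measurable B by exact: measurable_enorm_le.
have K0 : 0 <= K.
  rewrite leNgt; apply/negP => K0; suff B0 : B = set0.
    by move: muB; rewrite B0 measure0 => /eqP; rewrite eq_sym onee_eq0.
  rewrite -subset0 => y; rewrite /B /= leNgt.
  by rewrite (lt_le_trans K0 (enorm_ge0 y)).
pose alpha : probability (rV * rV)%type R := (mu \x nu)%E.
have alphaE A C : measurable A -> measurable C -> alpha (A `*` C) = (mu A * nu C)%E.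
  by move=> mA mC; rewrite -product_measure1E.
have : couplings mu nu alpha.
  by move=> A mA; rewrite !alphaE//= !probability_setT mule1 mul1e.
move=> alphaP; apply: (@le_trans _ _ (\int[alpha]_z (enorm (z.1 - z.2))%:E)%E).
  by apply: ereal_inf_lbound; exists alpha.
apply: (@le_trans _ _ (\int[alpha]_z (cst (2 * K)%:E z))%E); last first.
  rewrite integral_cst// (_ : _ setT = 1%E) ?mule1//.
  exact: (@probability_setT _ _ _ alpha).
apply: ae_ge0_le_integral => //.
- by move=> z _; rewrite lee_fin enorm_ge0.
- exact: measurable_enorm_dist.
- by move=> z _; rewrite lee_fin mulr_ge0.
exists (~` (B `*` B)); split.
- by apply: measurableC; exact: measurableX.
- apply: etrans (@probability_setC _ _ _ alpha _ _) _; first exact: measurableX.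
  have := alphaE _ _ mB mB; rewrite muB nuB mule1 => alphaB.
  by rewrite -[RHS](@subee _ 1%E)//; congr (_ - _)%E.
- move=> z /= H [Bz1 Bz2]; apply: H => _; rewrite lee_fin.
  exact: enorm_sub_le.
Qed.

End wasserstein_lemmas.

(** * Mixing couplings of the state laws *)

Section mixture.
Context (R : realType) (p M : nat).
Local Notation rV := 'rV[R]_p.

(** Lifts a pair of outcomes to the set where both state coordinates agree, on which the couplings
    in [eW1] must be concentrated. *)
Definition diag_state (j : 'I_M.+1) (z : rV * rV) := ((j, z.1), (j, z.2)).

Lemma measurable_diag_state j : measurable_fun setT (diag_state j).
Proof.
by apply: measurable_fun_pair; apply: measurable_fun_pair;
  [exact: measurable_cst|exact: measurable_fst
  |exact: measurable_cst|exact: measurable_snd].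
Qed.

HB.instance Definition _ j :=
  @isMeasurableFun.Build _ _ _ _ (diag_state j) (@measurable_diag_state j).

Lemma exists_state_mixture (q : 'I_M.+1 -> R)
    (alpha : 'I_M.+1 -> probability (rV * rV)%type R) :
  (forall j, 0 <= q j) -> \sum_j q j = 1 ->
  exists gamma : probability (('I_M.+1 * rV) * ('I_M.+1 * rV))%type R,
    (forall A, measurable A ->
      gamma A = \sum_j (q j)%:E * alpha j (diag_state j @^-1` A))%E /\
    forall f, measurable_fun setT f -> (forall z, (0 <= f z)%E) ->
      (\int[gamma]_z f z =
       \sum_j (q j)%:E * \int[alpha j]_z f (diag_state j z))%E.
Proof.
move=> q0 q1.
(* [gamma] is the sum of the images of [alpha j] under [diag_state j] with weights [q j]. As [msum]
   takes a sequence over [nat], the states are reached through [inord]. *)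
pose m_ (k : nat) := mscale (NngNum (q0 (inord k)))
  (distribution (alpha (inord k)) (diag_state (inord k) : {mfun _ >-> _})).
pose mu := msum m_ M.+1.
have muE A : mu A = (\sum_j (q j)%:E * alpha j (diag_state j @^-1` A))%E.
  rewrite /mu /msum /=; apply: eq_bigr => j _.
  by rewrite /m_ /mscale /= inord_val.
have mu1 : mu setT = 1%E.
  rewrite muE; under eq_bigr do rewrite preimage_setT probability_setT mule1.
  by rewrite sumEFin q1.
pose Q := HB.pack_for (probability (('I_M.+1 * rV) * ('I_M.+1 * rV))%type R) mu
  (Measure_isProbability.Build _ _ _ mu mu1).
exists Q; split => [A mA|f mf f0]; first exact: muE.
rewrite [LHS](_ : _ = \int[mu]_z f z)%E//.
rewrite ge0_integral_measure_sum//; apply: eq_bigr => j _.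
rewrite ge0_integral_mscale// ge0_integral_distribution//= inord_val.
by [].
Qed.

Lemma eW1_state_mix_le (q : 'I_M.+1 -> R) (mu nu : 'I_M.+1 -> set rV -> \bar R) :
  (forall j, 0 < q j) -> \sum_j q j = 1 ->
  (eW1 (state_mix q mu) (state_mix q nu) <= \sum_j (q j)%:E * W1 (mu j) (nu j))%E.
Proof.
move=> q0 q1.
have term_ge0 j : (0 <= (q j)%:E * W1 (mu j) (nu j))%E.
  by rewrite mule_ge0// ?W1_ge0// lee_fin ltW.
(* One infinite distance makes the right side infinite because its weight is positive. Otherwise
   there are couplings within [e] of every infimum, and as the weights sum to 1 the total excess is
   at most [e]. *)
have [/forallP Wfin|/forallPn[j Wj]] :=
    boolP [forall j, W1 (mu j) (nu j) \is a fin_num]; last first.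
  rewrite (bigD1 j)//=; move: Wj.
  rewrite ge0_fin_numE ?W1_ge0// -leNgt leye_eq => /eqP ->.
  rewrite gt0_muley ?lte_fin// addye ?leey//.
  by rewrite -ltNye (@lt_le_trans _ _ 0%E)// sume_ge0.
apply/lee_addgt0Pr => e e0.
have near j : exists alpha : probability (rV * rV)%type R,
    couplings (mu j) (nu j) alpha /\
    (\int[alpha]_z (enorm (z.1 - z.2))%:E < W1 (mu j) (nu j) + e%:E)%E.
  by have [_ [alpha aP <-] ae] := lb_ereal_inf_adherent e0 (Wfin j); exists alpha.
have {near}[alpha alphaP] := choice near.
have [gamma [gammaE int_gamma]] := exists_state_mixture alpha (fun j => ltW (q0 j)) q1.
have mdist : measurable_fun [set: ('I_M.+1 * rV) * ('I_M.+1 * rV)]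
    (fun z => (enorm (z.1.2 - z.2.2))%:E).
  apply: (measurableT_comp (@measurable_enorm_dist R p) (_ : measurable_fun _
    (fun z : ('I_M.+1 * rV) * ('I_M.+1 * rV) => (z.1.2, z.2.2)))).
  by apply: measurable_fun_pair; apply: measurableT_comp measurable_snd _;
    [exact: measurable_fst|exact: measurable_snd].
apply: (@le_trans _ _ (\int[gamma]_z (enorm (z.1.2 - z.2.2))%:E)%E).
  apply: ereal_inf_lbound; exists gamma => //; split.
    move=> A mA; rewrite !gammaE//; last 2 first.
    - exact: measurableX.
    - exact: measurableX.
    split; apply: eq_bigr => j _; congr (_ * _)%E.
    - have [<- _] := (alphaP j).1 _ (measurable_xsection j mA).
      congr (alpha j _); apply/seteqP.
      by split => z; rewrite /diag_state /xsection /= inE => -[].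
    - have [_ <-] := (alphaP j).1 _ (measurable_xsection j mA).
      congr (alpha j _); apply/seteqP.
      by split => z; rewrite /diag_state /xsection /= inE => -[].
  have mst (i : 'I_M.+1) (h : ('I_M.+1 * rV) * ('I_M.+1 * rV) -> 'I_M.+1 * rV) :
      measurable_fun setT h -> measurable [set z | (h z).1 = i].
    move=> mh; have mh1 : measurable_fun setT (fst \o h).
      exact: measurableT_comp measurable_fst mh.
    by rewrite -[X in measurable X]setTI; exact: (mh1 measurableT [set i] I).
  (* [N] consists of the points whose two states differ; it is null because no [diag_state j] takes
     a value in it. *)
  pose N := ~` \big[setU/set0]_(j < M.+1) ([set z | z.1.1 = j] `&` [set z | z.2.1 = j])
    : set (('I_M.+1 * rV) * ('I_M.+1 * rV)).
  have mN : measurable N.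
    apply: measurableC; apply: bigsetU_measurable => j _; apply: measurableI.
    - exact: mst measurable_fst.
    - exact: mst measurable_snd.
  exists N; split => //.
    rewrite gammaE//; apply: big1 => j _.
    rewrite (_ : _ @^-1` _ = set0) ?measure0 ?mule0//.
    rewrite -subset0 => z; apply; rewrite -bigcup_seq.
    by exists j => //=; rewrite mem_index_enum.
  move=> z /= zN; rewrite /N -bigcup_seq => -[j _ [/= z1 z2]].
  by apply: zN; rewrite z1 z2.
rewrite int_gamma//; last by move=> z; rewrite lee_fin enorm_ge0.
apply: (@le_trans _ _ (\sum_j (q j)%:E * (W1 (mu j) (nu j) + e%:E))%E).
  apply: lee_sum => j _; apply: lee_wpmul2l; first by rewrite lee_fin ltW.
  exact: ltW (alphaP j).2.
under eq_bigr => j _ do rewrite muleDr ?fin_num_adde_defl//.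
rewrite big_split /=; apply: leeD2l; under eq_bigr do rewrite -EFinM.
by rewrite sumEFin -mulr_suml q1 mul1r.
Qed.
End mixture.

(** * Splitting the product min-max problem into its coordinates *)

Section minmax_decoupling.
Context (R : realType).

Lemma finite_has_max (A : set R) : finite_set A -> A !=set0 ->
  exists2 a, A a & ubound A a.
Proof.
move=> /finite_seqP[s As]; rewrite {A}As; elim: s => [[]//|x s IH _].
have [s0|/set0P/IH [a sa au]] := eqVneq [set` s] set0.
  exists x => /=; rewrite ?inE ?eqxx// => y /=; rewrite inE => /orP[/eqP->//|ys].
  by have : [set` s] y by []; rewrite s0.
exists (Num.max x a) => /=.
  by rewrite inE; case: leP => _; rewrite ?eqxx//= sa orbT.
move=> y /=; rewrite inE le_max => /orP[/eqP ->|/au ->]; rewrite ?lexx ?orbT//.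
Qed.

(** Finiteness makes the real [sup], which has a default value on unbounded sets, a true maximum;
    its maximizers can then be chosen coordinate by coordinate. *)
Lemma sup_finite_attained S (D : set S) (f : S -> R) : finite_set D -> D !=set0 ->
  exists2 x, D x & sup [set f y | y in D] = f x /\ forall y, D y -> f y <= f x.
Proof.
move=> fD D0.
have [_ [x Dx <-] fxu] :=
  finite_has_max (finite_image f fD) (image_nonempty f D0).
exists x => //; split; last by move=> y Dy; apply: fxu; exists y.
apply/eqP; rewrite eq_le; apply/andP; split.
  by apply: ge_sup => //; exact: image_nonempty.
by apply: ub_le_sup; [exists (f x)|exists x].
Qed.

Lemma minmax_prod_class M T S (G : set T) (D : set S) (q : 'I_M.+1 -> R)
    (ell : 'I_M.+1 -> T -> S -> R) (ghat : 'I_M.+1 -> T) (j : 'I_M.+1) :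
  finite_set D -> (forall i, 0 < q i) ->
  minmax (prod_class G) (prod_class D)
    (fun g h => \sum_i q i * ell i (g i) (h i)) 0 ghat ->
  minmax G D (ell j) 0 (ghat j).
Proof.
move=> fD q0 [Gghat ghat_min]; split => // g Gg.
have [->|/set0P D0] := eqVneq D set0; first by rewrite !image_set0 addr0.
(* The critic coordinates vary freely, so the tuple [k] of coordinatewise maximizers attains the
   supremum of the sum. *)
have supE (h : 'I_M.+1 -> T) :
    sup [set \sum_i q i * ell i (h i) (k i) | k in prod_class D] =
    \sum_i q i * sup [set ell i (h i) k | k in D].
  have H i := sup_finite_attained (ell i (h i)) fD D0.
  pose k i := s2val (cid2 (H i)).
  have Dk i : D (k i) := s2valP (cid2 (H i)).
  have kE i : sup [set ell i (h i) k | k in D] = ell i (h i) (k i) :=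
    (s2valP' (cid2 (H i))).1.
  have kU i : forall y, D y -> ell i (h i) y <= ell i (h i) (k i) :=
    (s2valP' (cid2 (H i))).2.
  under [RHS]eq_bigr do rewrite kE.
  have ubk : ubound [set \sum_i q i * ell i (h i) (k i) | k in prod_class D]
      (\sum_i q i * ell i (h i) (k i)).
    move=> _ [k' Dk' <-]; apply: ler_sum => i _.
    by rewrite ler_pM2l//; exact: kU.
  apply/eqP; rewrite eq_le; apply/andP; split.
    by apply: ge_sup => //; exists (\sum_i q i * ell i (h i) (k i)); exists k.
  by apply: ub_le_sup; [eexists; exact: ubk|exists k].
(* The competitor differs from [ghat] in coordinate [j] only; all other terms cancel, and then so
   does the factor [q j > 0]. *)
pose g' i := if i == j then g else ghat i.
have Gg' : prod_class G g' by move=> i; rewrite /g'; case: ifP => _ //; exact: Gghat.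
have := ghat_min _ Gg'; rewrite !supE !addr0 (bigD1 j)//= [leRHS](bigD1 j)//=.
rewrite {1}/g' eqxx [X in _ <= _ + X](eq_bigr (fun i =>
  q i * sup [set ell i (ghat i) k | k in D])); last first.
  by move=> i /negPf ij; rewrite /g' ij.
by rewrite lerD2r ler_pM2l.
Qed.

End minmax_decoupling.

(** * A Chernoff bound for the size of a random subset *)

Lemma binomial_lower_tail (R : realType) (n : nat) (x : R) : 0 <= x <= 1 ->
  \sum_(S : {set 'I_n} | #|S|%:R < n%:R * x / 4) \prod_i (if i \in S then x else 1 - x)
    <= expR (- (n%:R * x / 4)).
Proof.
move=> /andP[x0 x1]; set t := n%:R * x / 4.
have e1 : expR (- 1) <= 2^-1 :> R.
  rewrite expRN lef_pV2 ?posrE ?expR_gt0//.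
  by have := expR_ge1Dx (1 : R).
have w_ge0 (S : {set 'I_n}) : 0 <= \prod_i (if i \in S then x else 1 - x).
  by apply: prodr_ge0 => i _; case: ifP; rewrite ?subr_ge0.
(* Chernoff: the indicator of [|S| < t] is at most [exp (t - |S|)] *)
apply: (@le_trans _ _ (\sum_(S in {set 'I_n})
    expR t * \prod_i (if i \in S then x * expR (- 1) else 1 - x))).
  rewrite big_mkcond /=; apply: ler_sum => S _.
  have -> : \prod_i (if i \in S then x * expR (- 1) else 1 - x) =
      expR (- #|S|%:R) * \prod_i (if i \in S then x else 1 - x).
    rewrite -[in RHS](mulr1 #|S|%:R) -mulrN expRM_natl -prodr_const.
    rewrite [X in _ = X * _]big_mkcond -big_split /=; apply: eq_bigr => i _.
    by case: ifP => _; rewrite ?mul1r// mulrC.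
  rewrite mulrA -expRD; case: ifP => [St|_].
    by rewrite ler_peMl// (le_trans _ (expR_ge1Dx _))// lerDl subr_ge0 ltW.
  by rewrite mulr_ge0// expR_ge0.
(* Distributivity turns the sum over subsets into [(x * exp(-1) + 1 - x)^n]. Since [exp(-1) <= 1/2],
   this is at most [exp(- n x / 2)], and the factor [exp t] with [t = n x / 4] leaves
   [exp(- n x / 4)]. *)
rewrite -mulr_sumr -bigA_distr prodr_const card_ord.
apply: (@le_trans _ _ (expR t * expR (n%:R * - (x / 2)))).
  rewrite ler_pM2l ?expR_gt0// expRM_natl.
  apply: lerXn2r; rewrite ?nnegrE ?expR_ge0//.
    by rewrite addr_ge0 ?mulr_ge0 ?expR_ge0 ?subr_ge0.
  by apply: le_trans (expR_ge1Dx _); rewrite /=; have := ler_wpM2l x0 e1; lra.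
by rewrite -expRD ler_expR /t; lra.
Qed.

(** * Identification of the outcome laws from the observational law *)

Section causal_identification.
Context (R : realType).

Lemma le_measure_ae d (T : measurableType d) (mu : measure T R) (A B : set T) :
  measurable A -> measurable B -> {ae mu, forall x, A x -> B x} -> (mu A <= mu B)%E.
Proof.
move=> mA mB [N [mN muN sN]].
apply: (@le_trans _ _ (mu (B `|` N))).
  apply: le_measure; rewrite ?inE//; first exact: measurableU.
  move=> x Ax; have [Bx|Bx] := pselect (B x); [by left|right].
  by apply: sN => /= /(_ Ax).
have muN0 : (mu N <= 0)%E by rewrite muN.
apply: le_trans (measureU2 _ _ _) _ => //.
by rewrite -[leRHS]adde0; apply: leeD.
Qed.

Context (M p : nat) (Y : set 'rV[R]_p) (m : causal_model M Y).

(** The covariate is a function of the state, whose sigma-algebra is discrete; hence [B] may be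
    arbitrary. *)
Lemma measurable_cm_X_preimage (B : set (covariates m)) :
  measurable (@cm_X _ _ _ _ m @^-1` B).
Proof.
have := @cm_W_meas _ _ _ _ m measurableT [set j | B (state m j).1] I.
by rewrite setTI.
Qed.

Lemma measurable_cm_W_preimage (B : set 'I_M.+1) : measurable (@cm_W _ _ _ _ m @^-1` B).
Proof. by have := @cm_W_meas _ _ _ _ m measurableT B I; rewrite setTI. Qed.

Lemma measurable_cm_Y_preimage t (A : set 'rV[R]_p) : measurable A ->
  measurable (@cm_Y _ _ _ _ m t @^-1` A).
Proof. by move=> mA; have := @cm_Y_meas _ _ _ _ m t measurableT A mA; rewrite setTI. Qed.

Lemma cm_W_preimage1 j : @cm_W _ _ _ _ m @^-1` [set j] =
  @cm_T _ _ _ _ m @^-1` [set (state m j).2] `&` @cm_X _ _ _ _ m @^-1` [set (state m j).1].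
Proof.
apply/seteqP; split => [w /= Wj|w [/= T_ X_]].
  by rewrite /cm_T /cm_X /= Wj.
apply: (@state_inj _ _ _ _ m); move: T_ X_; rewrite /cm_T /cm_X.
by case: (state m (cm_W w)) (state m j) => [? ?] [? ?] /= -> ->.
Qed.

Lemma cm_X_positive j : 0 < pi_obs m j ->
  0 < fine (cm_prob m (@cm_X _ _ _ _ m @^-1` [set (state m j).1])).
Proof.
move=> pi0; apply: lt_le_trans pi0 _; apply: fine_le.
- exact: fin_num_measure (measurable_cm_W_preimage _).
- exact: fin_num_measure (measurable_cm_X_preimage _).
apply: le_measure; rewrite ?inE.
- exact: measurable_cm_W_preimage.
- exact: measurable_cm_X_preimage.
- by rewrite cm_W_preimage1; exact: subIsetr.
Qed.

(** On the event [W = j], that is [X = x] and [T = t], consistency replaces the observed outcome by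
    [Y(t)]. Ignorability then factors the probability given [X = x]. *)
Lemma P_obs_rectangle j (A : set 'rV[R]_p) : consistency m -> ignorability m ->
  0 < pi_obs m j -> measurable A ->
  P_obs m ([set j] `*` A) = ((pi_obs m j)%:E * mu_star m j A)%E.
Proof.
move=> cons ign pi0 mA; set t := (state m j).2; set x := (state m j).1.
have X0 : 0 < fine (cm_prob m (@cm_X _ _ _ _ m @^-1` [set x])) := cm_X_positive pi0.
pose Yt := @cm_Y _ _ _ _ m t @^-1` A.
have mYt : measurable Yt by exact: measurable_cm_Y_preimage.
pose E1 := @cm_W _ _ _ _ m @^-1` [set j] `&` @cm_Yobs _ _ _ _ m @^-1` A.
pose E2 := @cm_W _ _ _ _ m @^-1` [set j] `&` Yt.
have mE2 : measurable E2 by apply: measurableI => //; exact: measurable_cm_W_preimage.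
have mE1 : measurable E1.
  apply: measurableI; first exact: measurable_cm_W_preimage.
  by have := @cm_Yobs_meas _ _ _ _ m measurableT A mA; rewrite setTI.
have E12 : cm_prob m E1 = cm_prob m E2.
  apply/eqP; rewrite eq_le; apply/andP; split; apply: le_measure_ae => //.
  - apply: filterS cons => w Yw [/= Wj]; rewrite Yw => YA; split => //.
    by move: YA; rewrite /cm_T Wj.
  - apply: filterS cons => w Yw [/= Wj YA]; split => //=.
    by rewrite Yw /cm_T Wj.
rewrite (_ : P_obs m _ = cm_prob m E1)// E12.
rewrite -(fineK (fin_num_measure (cm_prob m) _ mE2)) /mu_star -EFinM; congr (_%:E).
have := ign t x A [set t] mA; rewrite /cprob /=.
have -> : Yt `&` @cm_T _ _ _ _ m @^-1` [set t] `&` @cm_X _ _ _ _ m @^-1` [set x] = E2.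
  by rewrite /E2 cm_W_preimage1 [RHS]setIC setIA.
rewrite -cm_W_preimage1.
(* Multiplying by the probability of [X = x], positive because it dominates that of [W = j],
   recovers unconditional probabilities. *)
move=> /(congr1 ( *%R^~ (fine (cm_prob m (@cm_X _ _ _ _ m @^-1` [set x]))))).
rewrite divfK ?gt_eqF// => ->.
by rewrite mulrA divfK ?gt_eqF// mulrC.
Qed.

(** Exhibits [mu_star] as a bundled probability: the law of [Y(t)] under the conditional measure
    given [X = x]. *)
Lemma mu_star_law j (K : R) : 0 < pi_obs m j -> Y `<=` [set y | enorm y <= K] ->
  exists2 mu : probability 'rV[R]_p R,
    forall A, measurable A -> mu_star m j A = mu A &
    mu [set y | enorm y <= K] = 1%E.
Proof.
move=> pi0 YK; set t := (state m j).2; set x := (state m j).1.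
have X0 : 0 < fine (cm_prob m (@cm_X _ _ _ _ m @^-1` [set x])) := cm_X_positive pi0.
have mX := measurable_cm_X_preimage [set x].
have X0' : cm_prob m (@cm_X _ _ _ _ m @^-1` [set x]) != 0%E.
  by apply: contraTneq X0 => ->; rewrite ltxx.
pose Yt := HB.pack_for {mfun cm_space m >-> 'rV[R]_p} (@cm_Y _ _ _ _ m t)
  (@isMeasurableFun.Build _ _ _ _ (@cm_Y _ _ _ _ m t) (@cm_Y_meas _ _ _ _ m t)).
pose mu := distribution (conditional (cm_prob m) mX) Yt.
exists mu => [A mA|].
  rewrite /mu /distribution /pushforward /=.
  apply/esym/(etrans (conditionalE _ X0' _)).
  rewrite /mu_star /cprob EFinM fineK//.
  by apply: fin_num_measure; apply: measurableI => //; exact: measurable_cm_Y_preimage.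
have YtK : Yt @^-1` [set y | enorm y <= K] = setT.
  by apply/seteqP; split => // w _; apply: YK; exact: cm_Y_in.
by rewrite -[RHS](@probability_setT _ _ _ (conditional (cm_prob m) mX)) -YtK.
Qed.

End causal_identification.

(** * The sample given the set of indices in state [j] *)

Section stratum.
Context (R : realType) (M p n dU : nat) (Y : set 'rV[R]_p) (m : causal_model M Y).
Context (d : measure_display) (Omega : measurableType d) (P : probability Omega R).
Context (W : 'I_n -> Omega -> 'I_M.+1) (Yo : 'I_n -> Omega -> 'rV[R]_p)
  (U : 'I_n * 'I_M.+1 -> Omega -> 'rV[R]_dU).
Hypothesis iid : iid_sample Y P (P_obs m) W Yo U.
Hypotheses (cons : consistency m) (ign : ignorability m).
Context (j : 'I_M.+1).
Hypothesis pi0 : 0 < pi_obs m j.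
Context (mu : probability 'rV[R]_p R).
Hypothesis muE : forall A, measurable A -> mu_star m j A = mu A.

(** Fixing the index set, and not just its size, leaves the outcomes of the stratum at deterministic
    positions. These events partition the sample space. *)
Definition stratum (S : {set 'I_n}) : set Omega :=
  [set w | [set i | W i w == j]%SET = S].

Definition stratum_weight (S : {set 'I_n}) : R :=
  \prod_i (if i \in S then pi_obs m j else 1 - pi_obs m j).

Let law_data i : has_law P (fun w => (W i w, Yo i w)) (P_obs m).
Proof. by case: iid. Qed.

Let law_latent lj : has_law P (U lj) (unif_cube R dU).
Proof. by case: iid. Qed.

Lemma measurable_stratum S : measurable (stratum S).
Proof.
have -> : stratum S = \bigcap_(i : 'I_n) [set w | (W i w == j) = (i \in S)].
  apply/seteqP; split => [w /= <- i _ /=|w H /=]; first by rewrite inE.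
  by apply/setP => i; rewrite inE H.
apply: fin_bigcap_measurable => // i _.
have mW : measurable_fun setT (fst \o (fun w => (W i w, Yo i w))).
  exact: measurableT_comp measurable_fst (law_data i).1.
by have := mW measurableT [set k | (k == j) = (i \in S)] I; rewrite setTI.
Qed.

Lemma P_obs_other :
  P_obs m (~` [set j] `*` setT) = (1 - pi_obs m j)%:E.
Proof.
rewrite (_ : P_obs m _ = cm_prob m (~` (@cm_W _ _ _ _ m @^-1` [set j]))); last first.
  congr (cm_prob m _); apply/seteqP; split => w //=; first by case.
have mW := measurable_cm_W_preimage m [set j].
rewrite probability_setC// EFinB; congr (_ - _)%E.
by rewrite /pi_obs fineK// fin_num_measure.
Qed.

(** Membership in the stratum is itself a condition on each datum separately, so the whole event is
    an intersection of one event per independent variable. *)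
Lemma stratum_rectangle (S : {set 'I_n}) (A : 'I_n -> set 'rV[R]_p)
    (B : 'I_n * 'I_M.+1 -> set 'rV[R]_dU) :
  (forall i, measurable (A i)) -> (forall lj, measurable (B lj)) ->
  P ([set w | (forall i, i \in S -> A i (Yo i w)) /\ forall lj, B lj (U lj w)]
       `&` stratum S) =
  ((stratum_weight S)%:E * \prod_(i in S) mu (A i) *
    \prod_lj unif_cube R dU (B lj))%E.
Proof.
move=> mA mB; have [_ _ _ _ indep] := iid.
(* Inside [S] the state must be [j] and the outcome lies in [A i]; outside [S] the state is anything
   else and the outcome is free. *)
pose C i := if i \in S then [set j] `*` A i else ~` [set j] `*` setT.
have mC i : measurable (C i).
  by rewrite /C; case: ifP => _; apply: measurableX.
pose E (s : 'I_n + 'I_n * 'I_M.+1) : set Omega := match s with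
  | inl i => (fun w => (W i w, Yo i w)) @^-1` C i
  | inr lj => U lj @^-1` B lj end.
have := indep E; rewrite /E.
have -> : \bigcap_i E i = [set w | (forall i, i \in S -> A i (Yo i w)) /\
    forall lj, B lj (U lj w)] `&` stratum S.
  apply/seteqP; split => [w H|w [[HA HB] HS] [i|lj] _].
  - split.
      split => [i iS|lj]; last by have := H (inr lj) I.
      by have := H (inl i) I; rewrite /E /C /= iS => -[].
    apply/setP => i; rewrite inE; have := H (inl i) I; rewrite /E /C /=.
    case: ifP => iS /= [].
    + by move=> ->; rewrite eqxx.
    + by move=> /eqP/negPf ->.
  - rewrite /E /C /=; move/setP/(_ i) : HS; rewrite inE; case: ifP => iS /= Wi.
    + by split; [exact/eqP|exact: HA].
    + by split => //; apply/eqP; rewrite Wi.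
  - exact: HB.
move=> -> ; last first.
  move=> [i|lj].
  - by exists (C i) => //; rewrite setTI.
  - by exists (B lj) => //; rewrite setTI.
rewrite big_sumType /=; congr (_ * _)%E; last first.
  by apply: eq_bigr => lj _; rewrite (law_latent lj).2.
rewrite /stratum_weight -prodEFin [X in (_ * X)%E]big_mkcond -big_split /=.
apply: eq_bigr => i _; rewrite (law_data i).2// /C; case: ifP => iS.
  by rewrite P_obs_rectangle// muE.
by rewrite P_obs_other mule1.
Qed.

Lemma stratum_prob S : P (stratum S) = (stratum_weight S)%:E.
Proof.
have := @stratum_rectangle S (fun=> setT) (fun=> setT) (fun=> measurableT) (fun=> measurableT).
under eq_bigr do rewrite probability_setT; rewrite big1_eq.
under eq_bigr do rewrite probability_setT; rewrite big1_eq !mule1 => <-.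
by congr (P _); apply/seteqP; split => [w Sw|w []//].
Qed.

(** Normalization cancels the stratum weight and leaves a product law. The marginals and the
    independence required by the oracle property are both read off from it. *)
Lemma stratum_conditional_rectangle (S : {set 'I_n}) (A : 'I_#|S| -> set 'rV[R]_p)
    (B : 'I_n -> set 'rV[R]_dU) : P (stratum S) != 0%E ->
  (forall i, measurable (A i)) -> (forall l, measurable (B l)) ->
  conditional P (measurable_stratum S)
    [set w | (forall k, A k (Yo (enum_val k) w)) /\ forall l, B l (U (l, j) w)] =
  (\prod_k mu (A k) * \prod_l unif_cube R dU (B l))%E.
Proof.
move=> PS0 mA mB; rewrite conditionalE//.
(* [A] is indexed by positions in the enumeration of [S]. [A'] and [B'] extend the constraints to
   all data and all latent draws by the full space; [enum_rank_in] requires the proof of membership,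
   hence the match. *)
pose A' i := if i \in S =P true is ReflectT iS then A (enum_rank_in iS i) else setT.
pose B' lj := if lj.2 == j then B lj.1 else setT.
have mA' i : measurable (A' i) by rewrite /A'; case: eqP.
have mB' lj : measurable (B' lj) by rewrite /B'; case: ifP.
have A'E k : A' (enum_val k) = A k.
  rewrite /A'; case: eqP => [iS|]; last by rewrite enum_valP.
  by rewrite enum_valK_in.
have -> : [set w | (forall k, A k (Yo (enum_val k) w)) /\ forall l, B l (U (l, j) w)] =
  [set w | (forall i, i \in S -> A' i (Yo i w)) /\ forall lj, B' lj (U lj w)].
  apply/seteqP; split => w /= [HA HB]; split.
  - by move=> i iS; rewrite -(enum_rankK_in iS iS) A'E.
  - by move=> [l k]; rewrite /B' /=; case: eqP => [->|].
  - by move=> k; rewrite -A'E; apply: HA; exact: enum_valP.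
  - by move=> l; have := HB (l, j); rewrite /B' /= eqxx.
have w0 : stratum_weight S != 0 by move: PS0; rewrite stratum_prob.
rewrite stratum_rectangle// stratum_prob /=.
have cancel_weight (a b : \bar R) :
    ((stratum_weight S)%:E * a * b * ((stratum_weight S)^-1)%:E = a * b)%E.
  by rewrite -(muleA (stratum_weight S)%:E) muleAC -EFinM mulfV ?mul1e.
rewrite cancel_weight.
congr (_ * _)%E.
  by rewrite big_enum_val; apply: eq_bigr => k _; rewrite A'E.
rewrite (eq_bigr (fun lj => (fun l k => unif_cube R dU (B' (l, k))) lj.1 lj.2)); last by case.
rewrite -(pair_bigA _ (fun l k => unif_cube R dU (B' (l, k)))) /=.
apply: eq_bigr => l _; rewrite (bigD1 j)//= big1 ?mule1; first by rewrite /B' /= eqxx.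
by move=> k /negPf kj; rewrite /B' /= kj probability_setT.
Qed.

Section conditional_sample.
Variable S : {set 'I_n}.
Hypothesis PS0 : P (stratum S) != 0%E.
Let Q := conditional P (measurable_stratum S).
Let Z (k : 'I_#|S|) := Yo (enum_val k).

Lemma conditional_law_data k : has_law Q (Z k) mu.
Proof.
split => [|A mA].
  rewrite (_ : Z k = snd \o (fun w => (W (enum_val k) w, Yo (enum_val k) w)))//.
  exact: measurableT_comp measurable_snd (law_data _).1.
(* The rectangle constrains slot [k] only. *)
have := @stratum_conditional_rectangle S
  (fun k' => if k' == k then A else setT) (fun=> setT) PS0.
rewrite [X in (_ * X)%E]big1 ?mule1; last by move=> l _; exact: probability_setT.
rewrite (bigD1 k)//= eqxx big1 ?mule1; last first.
  by move=> k' /negPf ->; rewrite probability_setT.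
move=> <-//; last by move=> k'; case: ifP.
congr (Q _); apply/seteqP; split => w /=.
  by move=> ZA; split => // k'; case: eqP => // ->.
by move=> [/(_ k)]; rewrite eqxx.
Qed.

Lemma conditional_law_latent l : has_law Q (U (l, j)) (unif_cube R dU).
Proof.
split => [|B mB]; first exact: (law_latent (l, j)).1.
have := @stratum_conditional_rectangle S
  (fun=> setT) (fun l' => if l' == l then B else setT) PS0.
rewrite [X in (X * _)%E]big1 ?mul1e; last by move=> k _; exact: probability_setT.
rewrite (bigD1 l)//= eqxx big1 ?mule1; last first.
  by move=> l' /negPf ->; rewrite probability_setT.
move=> <-//; last by move=> l'; case: ifP.
congr (Q _); apply/seteqP; split => w /=.
  by move=> UB; split => // l'; case: eqP => // ->.
by move=> [_ /(_ l)]; rewrite eqxx.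
Qed.

(** Events of the generated sigma-algebras are preimages, so their intersection is a rectangle. *)
Lemma conditional_independence :
  mutually_independent Q (fun s : 'I_#|S| + 'I_n =>
    match s with inl k => sigma_of (Z k) | inr l => sigma_of (U (l, j)) end).
Proof.
move=> E HE.
have HA k : exists2 A, measurable A & E (inl k) = Z k @^-1` A.
  by have [A mA <-] := HE (inl k); exists A => //; rewrite setTI.
have HB l : exists2 B, measurable B & E (inr l) = U (l, j) @^-1` B.
  by have [B mB <-] := HE (inr l); exists B => //; rewrite setTI.
pose A k := s2val (cid2 (HA k)); pose B l := s2val (cid2 (HB l)).
have mA k : measurable (A k) := s2valP (cid2 (HA k)).
have mB l : measurable (B l) := s2valP (cid2 (HB l)).
have EA k : E (inl k) = Z k @^-1` A k := s2valP' (cid2 (HA k)).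
have EB l : E (inr l) = U (l, j) @^-1` B l := s2valP' (cid2 (HB l)).
rewrite big_sumType /=.
under eq_bigr => k _ do rewrite EA (conditional_law_data k).2//.
under [X in (_ * X)%E]eq_bigr => l _ do rewrite EB (conditional_law_latent l).2//.
rewrite -stratum_conditional_rectangle//; congr (Q _).
apply/seteqP; split => [w H|w /= [HA' HB'] [k|l] _].
- split => [k|l].
  + by have := H (inl k) I; rewrite EA.
  + by have := H (inr l) I; rewrite EB.
- by rewrite EA; exact: HA'.
- by rewrite EB; exact: HB'.
Qed.

End conditional_sample.

End stratum.

(** * The law generated from a latent draw *)

Section generated_law.
Context (R : realType) (p dU : nat) (Y : set 'rV[R]_p).

Lemma measurable_cube : measurable (cube R dU).
Proof.
have -> : cube R dU = \bigcap_(i : 'I_dU) [set u | 0 <= u ord0 i <= 1].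
  by apply/seteqP; split => [u H i _|u H i]; [exact: H|exact: H].
apply: fin_bigcap_measurable => // i _.
have := measurable_coord i measurableT (measurable_itv `[0 : R, 1]).
by rewrite setTI; congr measurable; apply/seteqP; split => u /=; rewrite in_itv.
Qed.

(** A generator is measurable on the cube only. Composed with a draw that always lies in the cube,
    it is measurable on all of [Omega], and the law of the composite is [gen_law g]. *)
Lemma gen_law_probability d (Omega : measurableType d) (P : probability Omega R)
    (U : Omega -> 'rV[R]_dU) (g : 'rV[R]_dU -> 'rV[R]_p) (K : R) :
  has_law P U (unif_cube R dU) -> (forall w, cube R dU (U w)) ->
  measurable_fun (cube R dU) g -> (forall u, cube R dU u -> Y (g u)) ->
  Y `<=` [set y | enorm y <= K] ->
  exists2 nu : probability 'rV[R]_p R,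
    forall A, measurable A -> gen_law g A = nu A &
    nu [set y | enorm y <= K] = 1%E.
Proof.
move=> [mU lawU] Ucube mg gY YK.
have mgA A : measurable A -> measurable (cube R dU `&` g @^-1` A).
  by move=> mA; exact: (mg measurable_cube).
have UgA A : (g \o U) @^-1` A = U @^-1` (cube R dU `&` g @^-1` A).
  by apply/seteqP; split => [w gUA|w []].
have mgU : measurable_fun setT (g \o U).
  by move=> _ A mA; rewrite UgA; apply: mU => //; exact: mgA.
pose gU := HB.pack_for {mfun Omega >-> 'rV[R]_p} (g \o U)
  (@isMeasurableFun.Build _ _ _ _ (g \o U) mgU).
exists (distribution P gU) => [A mA|].
  by rewrite /gen_law -lawU -?UgA//; exact: mgA.
rewrite -[RHS](@probability_setT _ _ _ P); congr (P _).
by apply/seteqP; split => // w _; apply: YK; exact: gY.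
Qed.

End generated_law.

(** Keeping [E] in the conclusion records, for a stratum, which indices have state [j]. *)
Lemma conditional_ae d (T : measurableType d) (R : realType) (P : probability T R)
    (E : set T) (mE : measurable E) (A : set T) : P E != 0%E ->
  {ae P, forall w, A w} -> {ae conditional P mE, forall w, E w /\ A w}.
Proof.
move=> PE0 [N [mN PN sN]]; exists (N `|` ~` E); split.
- by apply: measurableU => //; exact: measurableC.
- apply: etrans (conditionalE mE PE0 _) _.
  rewrite setIUl setICl setU0 (_ : P (N `&` E) = 0%E) ?mul0e//.
  by apply: (subset_measure0 _ mN _ PN) => //; exact: measurableI.
move=> w /= nEA; have [Ew|Ew] := pselect (E w); [left|by right].
by apply: sN => Aw; apply: nEA.
Qed.

(** * The expected distance for one state *)

Section one_state.
Context (R : realType) (M p n dU : nat) (Y : set 'rV[R]_p) (y0 : 'rV[R]_p).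

(** As [S] is nonempty, [E_obs] is the empirical mean over [S] and not the anchor value, so the
    one-state loss is [loss1] up to reindexing. An exact minimizer is in particular one up to the
    inverse of [#|S|]. *)
Lemma minmax_L_disc_stratum (G : set ('rV[R]_dU -> 'rV[R]_p))
    (D : set ('rV[R]_p -> R)) (q : 'I_M.+1 -> R)
    (W : 'I_n -> 'I_M.+1) (Yo : 'I_n -> 'rV[R]_p)
    (U : 'I_n * 'I_M.+1 -> 'rV[R]_dU) ghat (j : 'I_M.+1) (S : {set 'I_n}) :
  finite_set D -> (forall i, 0 < q i) -> [set i | W i == j]%SET = S -> (0 < #|S|)%N ->
  minmax (prod_class G) (prod_class D) (L_disc q y0 W Yo U) 0 ghat ->
  minmax G D (loss1 (fun k : 'I_#|S| => Yo (enum_val k)) (fun l => U (l, j)))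
    #|S|%:R^-1 (ghat j).
Proof.
move=> fD q0 SE S0 mm.
have [Gj mj] := minmax_prod_class (ell := fun i g h =>
  E_obs y0 W Yo i h - n%:R^-1 * \sum_l h (g (U (l, i)))) j fD q0 mm.
split => // g Gg.
have -> : loss1 (fun k : 'I_#|S| => Yo (enum_val k)) (fun l => U (l, j)) =
  (fun g h => E_obs y0 W Yo j h - n%:R^-1 * \sum_l h (g (U (l, j)))).
  apply/funext => g'; apply/funext => h; rewrite /loss1 /E_obs SE.
  rewrite gtn_eqF//; congr (_ * _ - _).
  rewrite -(big_enum_val (fun i => h (Yo i))); apply: eq_bigl => i.
  by rewrite -SE inE.
apply: le_trans (mj _ Gg) _.
by rewrite addr0 lerDl invr_ge0.
Qed.

Context (m : causal_model M Y) (q : 'I_M.+1 -> R) (qmin kappa beta K0 : R).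
Hypothesis model : model_class m dU qmin kappa beta K0 q.
Hypothesis q_gt0 : forall i, 0 < q i.
Context (j : 'I_M.+1).
Hypothesis pi0 : 0 < pi_obs m j.
Hypotheses (YK : Y `<=` [set y | enorm y <= K0]).
Context (d : measure_display) (Omega : measurableType d) (P : probability Omega R).
Context (W : 'I_n -> Omega -> 'I_M.+1) (Yo : 'I_n -> Omega -> 'rV[R]_p)
  (U : 'I_n * 'I_M.+1 -> Omega -> 'rV[R]_dU)
  (ghat : Omega -> 'I_M.+1 -> 'rV[R]_dU -> 'rV[R]_p).
Context (C1 c1 : R -> R -> R)
  (G : nat -> set ('rV[R]_dU -> 'rV[R]_p)) (D : nat -> set ('rV[R]_p -> R)).
Hypothesis n2 : (2 <= n)%N.
Hypothesis sieve : sieve_classes Y G D.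
Hypothesis oracleGD : oracle Y beta K0 C1 c1 G D.
Hypothesis iid : iid_sample Y P (P_obs m) W Yo U.
Hypothesis wgan : wgan_estimator q y0 P W Yo U (G n) (D n) ghat.
Let f w := W1 (mu_star m j) (gen_law (ghat w j)).
Hypothesis mf : measurable_fun setT f.

Let f_ge0 w : (0 <= f w)%E. Proof. exact: W1_ge0. Qed.

Lemma W1_estimator_bounded : {ae P, forall w, (f w <= (2 * K0)%:E)%E}.
Proof.
have [mu muE muK] := mu_star_law pi0 YK.
have [_ _ lawU Ucube _] := iid.
(* Some latent draw is used to realize the generated law; [2 <= n] provides the index 0. *)
have l0 : 'I_n by exists 0%N; exact: ltn_trans n2.
apply: filterS wgan => w [Gw _].
have [Gmeas _ _] := sieve n2; have [mg gY] := Gmeas _ (Gw j).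
have [nu nuE nuK] := gen_law_probability (lawU (l0, j)) (Ucube (l0, j)) mg gY YK.
rewrite /f (eq_W1 _ muE).
apply: le_trans (W1_le_bound muK nuK).
rewrite le_eqVlt; apply/orP; left; apply/eqP.
rewrite /W1; congr (ereal_inf (image _ _)); apply/seteqP.
by split => alpha aP A mA; have [-> ->] := aP A mA; rewrite nuE.
Qed.

Lemma integral_stratum_oracle (S : {set 'I_n}) (r : R) : 0 < r -> (0 < #|S|)%N ->
  n%:R <= r * #|S|%:R ->
  (\int[P]_(w in stratum W j S) f w <= P (stratum W j S) *
    (C1 1 r * ln (maxn #|S| 2)%:R `^ c1 1 r * (maxn #|S| 1)%:R `^ (- rate beta dU))%:E)%E.
Proof.
move=> r0 S0 nS; have [[cons ign] _ _ _ models] := model.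
have [gstar gstarH gstarE] := models j.
have [mu muE muK] := mu_star_law pi0 YK.
have mS := measurable_stratum iid j S.
(* On a null stratum both sides vanish; otherwise the oracle is applied to the conditional
   measure. *)
have [PS0|PS0] := eqVneq (P (stratum W j S)) 0%E.
  rewrite PS0 mul0e null_set_integral//; exact: measurable_funS mf.
rewrite (ge0_integral_conditional mS PS0)//; apply: lee_wpmul2l => //.
have [_ YoY _ Ucube _] := iid.
have Sn : (#|S| <= n)%N by rewrite -[leqRHS]card_ord max_card.
have lawE A : measurable A -> mu A = gen_law gstar A.
  by move=> mA; rewrite -muE// gstarE.
have fE w : f w = W1 (gen_law gstar) (gen_law (ghat w j)) by exact: eq_W1.
have -> : f = fun w => W1 (gen_law gstar) (gen_law (ghat w j)) by exact/funext.
apply: (@oracleGD 1 r #|S| n n ltr01 r0 S0 n2 _ _ gstar gstarH d Omega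
  (conditional P mS) (fun k => Yo (enum_val k)) (fun l => U (l, j))
  (fun w => ghat w j)).
(* The ratio constants are 1 and [r]: [maxn #|S| 2 <= n], and [n <= r * #|S|] by hypothesis. *)
- rewrite mul1r ler_nat geq_max Sn n2 /=.
  by apply: le_trans nS _; rewrite ler_pM2l// ler_nat leq_maxl.
- exact: geq_minr.
- move=> k; have [mZ lawZ] := conditional_law_data iid cons ign pi0 muE PS0 k.
  by split => // A mA; rewrite lawZ// lawE.
- by move=> k w; exact: YoY.
- by move=> l; exact: (conditional_law_latent iid cons ign pi0 muE PS0).
- by move=> l w; exact: Ucube.
- exact: (conditional_independence iid cons ign pi0 muE PS0).
- apply: filterS (conditional_ae mS PS0 wgan) => w [Sw mmw].
  have [_ fD _] := sieve n2.
  exact: (minmax_L_disc_stratum fD q_gt0 Sw S0 mmw).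
- by rewrite (_ : (fun _ => _) = f)//; apply/funext => w; rewrite fE.
Qed.

Lemma integral_W1_le (r B : R) : 0 < r -> 4 / pi_obs m j <= r -> 0 <= B -> 0 <= K0 ->
  (forall k : nat, n%:R * pi_obs m j / 4 <= k%:R -> (k <= n)%N ->
    C1 1 r * ln (maxn k 2)%:R `^ c1 1 r * (maxn k 1)%:R `^ (- rate beta dU) <= B) ->
  (\int[P]_w f w <= (B + 2 * K0 * expR (- (n%:R * pi_obs m j / 4)))%:E)%E.
Proof.
move=> r0 rpi B0 K00 HB; set t := n%:R * pi_obs m j / 4.
have [[cons ign] _ _ _ _] := model.
have [mu muE muK] := mu_star_law pi0 YK.
have mS := measurable_stratum iid j.
have PE S : P (stratum W j S) = (stratum_weight m j S)%:E.
  exact: (stratum_prob iid cons ign pi0 muE).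
have w0 (S : {set 'I_n}) : 0 <= stratum_weight m j S by rewrite -lee_fin -PE.
have pi1 : pi_obs m j <= 1.
  rewrite -lee_fin /pi_obs fineK ?probability_le1//.
  - exact: measurable_cm_W_preimage.
  - exact/fin_num_measure/measurable_cm_W_preimage.
have t0 : 0 < t by rewrite /t !mulr_gt0// ltr0n; exact: ltn_trans n2.
rewrite (@ge0_integral_finpartition _ _ _ _ _ (stratum W j))//; last 2 first.
- by move=> S S' _ _ [w [<- <-]].
- by apply/seteqP; split => // w _; exists [set i | W i w == j]%SET.
(* One majorant serves all strata: the oracle bound [B] when [#|S| >= t], and the diameter [2 * K0]
   when [#|S| < t]. *)
apply: (@le_trans _ _ (\sum_S (stratum_weight m j S * B +
    (if (#|S|%:R < t) then 2 * K0 * stratum_weight m j S else 0))%:E)%E).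
  apply: lee_sum => S _; case: ltP => St.
    apply: (@le_trans _ _ (\int[P]_(w in stratum W j S) (cst (2 * K0)%:E w))%E).
      apply: ae_ge0_le_integral => //.
      - exact: measurable_funS mf.
      - by move=> w _; rewrite lee_fin mulr_ge0.
      - by apply: filterS W1_estimator_bounded => w.
    have -> : (\int[P]_(w in stratum W j S) (cst (2 * K0)%:E w) =
        (2 * K0)%:E * P (stratum W j S))%E by exact: integral_cst.
    by rewrite PE -EFinM lee_fin lerDr mulr_ge0.
  have S0 : (0 < #|S|)%N by rewrite -(@ltr0n R); exact: lt_le_trans St.
  rewrite addr0 EFinM -PE.
  apply: le_trans (integral_stratum_oracle r0 S0 _) _.
    apply: (@le_trans _ _ (4 / pi_obs m j * #|S|%:R)); last by rewrite ler_wpM2r.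
    rewrite -ler_pdivrMl ?divr_gt0// invf_div.
    by apply: le_trans St; rewrite /t; lra.
  apply: lee_wpmul2l => //; rewrite lee_fin; apply: HB => //.
  by rewrite -[leqRHS]card_ord max_card.
rewrite sumEFin lee_fin big_split /=; apply: lerD.
  (* The weights of all subsets sum to [(pi + (1 - pi))^n = 1]. *)
  rewrite -mulr_suml ler_piMl// le_eqVlt; apply/orP; left; apply/eqP.
  rewrite /stratum_weight -bigA_distr prodr_const.
  by rewrite /= addrC subrK expr1n.
rewrite -big_mkcond -mulr_sumr ler_wpM2l ?mulr_ge0//.
by apply: binomial_lower_tail; rewrite pi1 ltW.
Qed.

End one_state.

(** * Comparison with the rate in [n] *)

Section rates.
Context (R : realType).
Local Notation L := (ln (2 : R)).

Lemma rate_bounds (beta : R) dU : 0 < beta -> 0 < rate beta dU <= 1.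
Proof.
move=> b0; rewrite /rate lt_min ge_min; apply/andP; split.
  apply/andP; split; last by rewrite invr_gt0.
  by apply: divr_gt0; [exact: addr_gt0|rewrite ltr_pwDl ?mulr_gt0].
by apply/orP; right; rewrite invf_le1// ler1n.
Qed.

(** Dividing the logarithms by [ln 2] makes them at least 1, so raising the exponent from [c1] to
    [c] only increases the bound, whatever the sign of [c1]. The absolute value covers a negative
    [C1]. The power of [k] is handled by [k >= n * rho]. *)
Lemma oracle_rate_le (C1 c1 c a rho : R) (n k : nat) :
  0 <= a -> 0 < rho -> c1 <= c -> 0 <= c -> (2 <= n)%N -> (k <= n)%N ->
  n%:R * rho <= k%:R ->
  C1 * ln (maxn k 2)%:R `^ c1 * (maxn k 1)%:R `^ (- a) <=
    `|C1| * L `^ c1 * rho `^ (- a) * (L^-1 * ln n%:R) `^ c * n%:R `^ (- a).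
Proof.
move=> a0 rho0 c1c c0 n2 kn nk.
have n0 : 0 < n%:R :> R by rewrite ltr0n; exact: ltn_trans n2.
have k0 : 0 < k%:R :> R by apply: lt_le_trans nk; exact: mulr_gt0.
have L0 : 0 < L by rewrite ln_gt0 ?ltr1n.
set x := ln (maxn k 2)%:R.
have Lx : L <= x by rewrite ler_ln ?posrE ?ltr0n ?ler_nat ?leq_maxr// leq_max orbT.
have xn : x <= ln n%:R.
  by rewrite ler_ln ?posrE// ler_nat geq_max kn n2.
have logs : x `^ c1 <= L `^ c1 * (L^-1 * ln n%:R) `^ c.
  have xL : 1 <= L^-1 * x by rewrite ler_pdivlMl// mulr1.
  rewrite -[in leLHS](mulVKf (lt0r_neq0 L0) x) powRM ?(ltW L0)//; last exact: le_trans xL.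
  rewrite ler_wpM2l ?powR_ge0//; apply: le_trans (ler_powR xL c1c) _.
  apply: ge0_ler_powR => //; rewrite ?nnegrE.
  - exact: le_trans xL.
  - by rewrite mulr_ge0 ?invr_ge0 ?(ltW L0)// (le_trans (ltW L0))// (le_trans Lx).
  - by rewrite ler_wpM2l ?invr_ge0 ?(ltW L0).
have size : (maxn k 1)%:R `^ (- a) <= rho `^ (- a) * n%:R `^ (- a).
  have -> : maxn k 1 = k by apply/maxn_idPl; rewrite -(@ltr0n R).
  rewrite -powRM ?(ltW rho0) ?(ltW n0)// !powRN.
  rewrite lef_pV2 ?posrE ?powR_gt0 ?mulr_gt0//.
  apply: ge0_ler_powR; rewrite ?nnegrE ?(ltW k0)//; last by rewrite mulrC.
  by rewrite mulr_ge0 ?(ltW rho0) ?(ltW n0).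
apply: (@le_trans _ _ (`|C1| * x `^ c1 * (maxn k 1)%:R `^ (- a))).
  by rewrite ler_wpM2r ?powR_ge0// ler_wpM2r ?powR_ge0// ler_norm.
rewrite -mulrA.
apply: (@le_trans _ _ (`|C1| * ((L `^ c1 * (L^-1 * ln n%:R) `^ c) *
    (rho `^ (- a) * n%:R `^ (- a))))).
  by rewrite ler_wpM2l// ler_pM ?powR_ge0.
by rewrite le_eqVlt; apply/orP; left; apply/eqP; ring.
Qed.

(** From [exp t >= t >= n * rho] the left side is at most a multiple of [1 / n], hence of [n^(-a)]
    as [a <= 1]; the normalized logarithmic factor is at least 1. *)
Lemma expRN_rate_le (c a rho t : R) (n : nat) :
  a <= 1 -> 0 < rho -> 0 <= c -> (2 <= n)%N -> n%:R * rho <= t ->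
  expR (- t) <= rho^-1 * (L^-1 * ln n%:R) `^ c * n%:R `^ (- a).
Proof.
move=> a1 rho0 c0 n2 nt.
have n0 : 0 < n%:R :> R by rewrite ltr0n; exact: ltn_trans n2.
have L0 : 0 < L by rewrite ln_gt0 ?ltr1n.
apply: (@le_trans _ _ (rho^-1 * n%:R^-1)).
  rewrite -invfM expRN lef_pV2 ?posrE ?expR_gt0 ?mulr_gt0// mulrC.
  by apply: le_trans nt _; apply: le_trans (expR_ge1Dx t); rewrite lerDr.
rewrite -mulrA ler_wpM2l ?invr_ge0 ?(ltW rho0)//.
apply: (@le_trans _ _ (n%:R `^ (- a))).
  rewrite -[leLHS]powR_inv1 ?(ltW n0)// ler_powR ?lerN2// ler1n.
  exact: ltn_trans n2.
rewrite ler_peMl ?powR_ge0//.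
apply: (@le_trans _ _ (1 `^ c)); first by rewrite powR1.
apply: ge0_ler_powR; rewrite ?nnegrE//.
  by rewrite mulr_ge0 ?invr_ge0 ?(ltW L0)// ltW// ln_gt0// ltr1n.
by rewrite ler_pdivlMl// mulr1 ler_ln ?posrE// ler_nat.
Qed.

End rates.

(** * Choice of the constants and summation over the states *)

Theorem theorem1 (R : realType) (M dU : nat) (qmin kappa beta K0 : R)
    (C1 c1 : R -> R -> R) :
  0 < qmin -> 0 < kappa <= 1 -> 0 < beta -> 0 < K0 ->
  exists C c : R, [/\ 0 < C, 0 < c &
    forall (p : nat) (Y : set 'rV[R]_p) (y0 : 'rV[R]_p)
      (G : nat -> set ('rV[R]_dU -> 'rV[R]_p)) (D : nat -> set ('rV[R]_p -> R)),
    compact Y -> Y `<=` [set y | enorm y <= K0] -> Y y0 ->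
    sieve_classes Y G D -> oracle Y beta K0 C1 c1 G D ->
    forall n : nat, (2 <= n)%N ->
    forall (m : causal_model M Y) (q : 'I_M.+1 -> R),
    model_class m dU qmin kappa beta K0 q ->
    forall (d : measure_display) (Omega : measurableType d)
      (P : probability Omega R)
      (W : 'I_n -> Omega -> 'I_M.+1) (Yo : 'I_n -> Omega -> 'rV[R]_p)
      (U : 'I_n * 'I_M.+1 -> Omega -> 'rV[R]_dU)
      (ghat : Omega -> 'I_M.+1 -> 'rV[R]_dU -> 'rV[R]_p),
    iid_sample Y P (P_obs m) W Yo U ->
    wgan_estimator q y0 P W Yo U (G n) (D n) ghat ->
    (forall j, measurable_fun setT
       (fun w => W1 (mu_star m j) (gen_law (ghat w j)))) ->
    (\int[P]_w eW1 (state_mix q (mu_star m))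
                   (state_mix q (fun j => gen_law (ghat w j))) <=
      (C * ln n%:R `^ c * n%:R `^ (- rate beta dU))%:E)%E].
Proof.
move=> qmin0 /andP[kappa0 _] beta0 K00.
(* Overlap gives [pi_j >= kappa * qmin], so [rho] bounds every [pi_j / 4] from below, and its
   inverse [r] is an upper ratio constant valid for all states and models. *)
pose rho := kappa * qmin / 4; pose r := rho^-1.
pose c := Num.max (c1 1 r) 1; pose a := rate beta dU; pose L := ln (2 : R).
have rho0 : 0 < rho by rewrite divr_gt0 ?mulr_gt0.
have r0 : 0 < r by rewrite invr_gt0.
have c0 : 0 < c by rewrite lt_max ltr01 orbT.
have L0 : 0 < L by rewrite ln_gt0 ?ltr1n.
have /andP[a0 a1] : 0 < a <= 1 := rate_bounds dU beta0.
pose C0 := `|C1 1 r| * L `^ c1 1 r * rho `^ (- a).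
have C00 : 0 <= C0 by rewrite !mulr_ge0 ?powR_ge0.
(* [C0] comes from the large strata and [2 * K0 * r] from the small ones; the last factor undoes the
   division of the logarithm by [ln 2]. *)
exists ((C0 + 2 * K0 * r) * L^-1 `^ c), c; split => //.
  rewrite mulr_gt0 ?powR_gt0 ?invr_gt0//.
  by rewrite ltr_wpDl// !mulr_gt0.
move=> p Y y0 G D _ YK _ sieve oracleGD n n2 m q model d Omega P W Yo U ghat iid wgan mW1.
have [_ q1 qge overlap _] := model.
have q0 j : 0 < q j by exact: lt_le_trans (qge j).
have qge0 j : 0 <= q j := ltW (q0 j).
have pi_ge j : kappa * qmin <= pi_obs m j.
  by rewrite -ler_pdivlMl//; exact: le_trans (qge j) (overlap j).
have pi0 j : 0 < pi_obs m j by apply: lt_le_trans (pi_ge j); exact: mulr_gt0.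
have n0 : 0 < n%:R :> R by rewrite ltr0n; exact: ltn_trans n2.
have rho_le j : n%:R * rho <= n%:R * pi_obs m j / 4.
  by rewrite /rho mulrA ler_pM2r ?invr_gt0// ler_pM2l.
pose T := (L^-1 * ln n%:R) `^ c * n%:R `^ (- a).
have T0 : 0 <= T by rewrite mulr_ge0 ?powR_ge0.
have W1_le j : (\int[P]_w W1 (mu_star m j) (gen_law (ghat w j)) <=
    ((C0 + 2 * K0 * r) * T)%:E)%E.
  apply: (@le_trans _ _
      (C0 * T + 2 * K0 * expR (- (n%:R * pi_obs m j / 4)))%:E).
    apply: (integral_W1_le model q0 (pi0 j) YK n2 sieve oracleGD iid wgan (mW1 j) r0).
    - rewrite ler_pdivrMr// mulrC -ler_pdivrMr// invrK /rho; have := pi_ge j; lra.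
    - exact: mulr_ge0.
    - exact: ltW.
    move=> k nk kn; rewrite /T mulrA.
    apply: oracle_rate_le => //; first exact: ltW.
    - by rewrite le_max lexx.
    - exact: ltW.
    - exact: le_trans nk.
  rewrite lee_fin [leRHS]mulrDl lerD2l -[leRHS]mulrA ler_wpM2l ?mulr_ge0 ?(ltW K00)//.
  by rewrite /T mulrA; apply: expRN_rate_le => //; exact: ltW.
apply: (@le_trans _ _
    (\int[P]_w (\sum_j (q j)%:E * W1 (mu_star m j) (gen_law (ghat w j))))%E).
  apply: ge0_le_integral_nomeas => w; first exact: eW1_ge0.
  exact: eW1_state_mix_le.
rewrite ge0_integral_sum//; last 2 first.
- by move=> j; exact: measurable_funeM.
- by move=> j w _; rewrite mule_ge0 ?W1_ge0// lee_fin ltW.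
(* The one-state bounds are averaged with weights summing to 1, so the number of states does not
   enter the constant. *)
apply: (@le_trans _ _ (\sum_j (q j * ((C0 + 2 * K0 * r) * T))%:E)%E).
  apply: lee_sum => j _; rewrite ge0_integralZl_EFin//; last first.
    by move=> w _; exact: W1_ge0.
  by rewrite EFinM lee_wpmul2l// lee_fin.
rewrite sumEFin lee_fin -mulr_suml q1 mul1r /T powRM ?invr_ge0 ?(ltW L0)//.
  by rewrite !mulrA.
by rewrite ltW// ln_gt0 ?ltr1n.
Qed.
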